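(* For every infinite Hausdorff topological space $X$, the space $H=\mathrm{USC}_p^{*}(X)$ does not satisfy the selection principle $\mathrm S_1(\mathcal P(H),\mathcal S(H))$.
   Context: The set ${}^X\mathbb R$ of all real functions on $X$ carries the product topology (pointwise convergence). $\mathrm{USC}_p^{*}(X)$ is the subspace of all bounded upper semicontinuous functions $f:X\to\mathbb R$ (i.e. $\{x:f(x)<a\}$ is open for every real $a$). $\mathrm S_1(\mathcal A,\mathcal B)$, for families $\mathcal A,\mathcal B$ of subsets of a set: for every sequence $\langle A_n:n\in\omega\rangle$ of elements of $\mathcal A$ there are $a_n\in A_n$ ($n\in\omega$) with $\{a_n:n\in\omega\}\in\mathcal B$. For $H\subseteq{}^X\mathbb R$: $\mathcal S(H)$ is the set of all $F\subseteq H$ sequentially dense in $H$, i.e. such that every $f\in H$ is the pointwise limit of a sequence of elements of $F$; $\mathcal P(H)$ is the set of all $F\subseteq H$ that are pointwise dense in $\mathbb R$, i.e. $\overline{\{f(x):f\in F\}}=\mathbb R$ for each $x\in X$. *)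

(* Defs.v *)
From HB Require Import structures.
From mathcomp Require Import all_boot all_order all_algebra.
From mathcomp Require Import all_classical all_reals all_analysis.

Set Implicit Arguments.
Unset Strict Implicit.
Unset Printing Implicit Defensive.

Import Order.TTheory GRing.Theory Num.Theory.
Import numFieldNormedType.Exports.

Local Open Scope classical_set_scope.
Local Open Scope ring_scope.

Definition S1 (T : Type) (A B : set (set T)) : Prop :=
  forall F : nat -> set T, (forall n, A (F n)) ->
    exists a : nat -> T, (forall n, F n (a n)) /\ B (range a).

Definition upper_semicontinuous (R : realType) (X : topologicalType)
    (f : X -> R) : Prop :=
  forall a : R, open [set x | f x < a].

(* Only the carrier set is recorded: convergence in the subspace USC_p^*(X)
   is convergence in the ambient product space {ptws X -> R}. *)
Definition USCb (R : realType) (X : topologicalType) : set {ptws X -> R} :=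
  [set f : X -> R | upper_semicontinuous f /\ bounded_fun f].

Definition seq_dense_subsets (R : realType) (X : topologicalType)
    (H : set {ptws X -> R}) : set (set {ptws X -> R}) :=
  [set F | F `<=` H /\
    forall f, H f -> exists2 u : nat -> {ptws X -> R},
      (forall n, F (u n)) & u @ \oo --> f].

Definition pointwise_dense_subsets (R : realType) (X : topologicalType)
    (H : set {ptws X -> R}) : set (set {ptws X -> R}) :=
  [set F | F `<=` H /\
    forall x : X, closure [set (f : X -> R) x | f in F] = [set: R]].

(* Main.v *)
(** Constant functions alone are already pointwise dense in the reals, and a
    pointwise limit of constant functions is constant; the indicator function
    of a point is upper semicontinuous (points are closed) but not constant. *)
Require Import Defs.
From HB Require Import structures.
From mathcomp Require Import all_boot all_order all_algebra.
From mathcomp Require Import all_classical all_reals all_analysis.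

Local Open Scope classical_set_scope.
Local Open Scope ring_scope.

Import Order.TTheory GRing.Theory Num.Theory.
Import numFieldNormedType.Exports.

Lemma USCb_cst (R : realType) (X : topologicalType) (c : R) :
  USCb (cst c : {ptws X -> R}).
Proof.
split=> [a|]; last first.
  (* Boundedness asks for a threshold beyond which every [M] bounds the function; [|c|] serves. *)
  by exists `|c|; split=> // M /ltW cM x _ /=.
suff [->|->] : [set _ : X | c < a] = setT \/ [set _ : X | c < a] = set0.
- exact: openT.
- exact: open0.
by case: (c < a); [left|right]; apply/seteqP; split.
Qed.

(** The sublevel set at [a] is the whole space for [1 < a], the complement of [A] for [0 < a <= 1],
    and empty for [a <= 0]; closedness of [A] makes the middle one open. *)
Lemma USCb_indic (R : realType) (X : topologicalType) (A : set X) :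
  closed A -> USCb (\1_A : {ptws X -> R}).
Proof.
move=> cA; split=> [a|]; last first.
  exists 1; split=> // M M1 x _ /=.
  by rewrite indicE normr_nat (le_trans _ (ltW M1))// lern1 leq_b1.
suff [->|[->|->]] : [set x | \1_A x < a] = setT \/
    [set x | \1_A x < a] = ~` A \/ [set x | \1_A x < a] = set0.
- exact: openT.
- exact: closed_openC.
- exact: open0.
have [a1|a1] := ltP 1 a; [left|right].
  by rewrite -subTset => x _ /=; rewrite (le_lt_trans _ a1)// indicE lern1 leq_b1.
have [a0|a0] := ltP 0 a; [left|right]; apply/seteqP; split=> x //=.
- by move=> xa Ax; move: xa; rewrite indicE mem_set//= ltNge a1.
- by move=> nAx; rewrite indicE memNset.
- by rewrite ltNge (le_trans a0)// indicE ler0n.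
Qed.

Lemma range_cst_pointwise_dense (R : realType) (X : topologicalType) :
  pointwise_dense_subsets (@USCb R X)
    (range (fun c : R => cst c : {ptws X -> R})).
Proof.
split=> [_ [c _ <-]|x]; first exact: USCb_cst.
rewrite -subTset => r _; apply: subset_closure.
by exists (cst r) => //; exists r.
Qed.

Theorem theorem6p4 (R : realType) (X : topologicalType)
    (Xinf : infinite_set [set: X]) (X_T2 : hausdorff_space X) :
  ~ S1 (pointwise_dense_subsets (@USCb R X)) (seq_dense_subsets (@USCb R X)).
Proof.
(* The same family of all constants is offered at every index, so whatever is selected is
   constant. *)
move=> /(_ (fun=> range (fun c : R => cst c : {ptws X -> R})))[].
  by move=> _; exact: range_cst_pointwise_dense.
move=> a [a_cst [_ a_dense]].
have [x _] : [set: X] !=set0 by exact: infinite_setN0.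
(* Otherwise [X] would lie in the finite set [[set x]]. *)
have [y yx] : exists y : X, y != x.
  apply: contrapT => /forallNP ne; apply: Xinf.
  apply: (sub_finite_set _ (finite_set1 x)) => y _ /=.
  by apply/eqP/negPn/negP; exact: ne.
have cx : closed [set x] by exact/accessible_closed_set1/hausdorff_accessible.
have [u uF uf] := a_dense _ (@USCb_indic R X _ cx).
have uxy : (fun n => u n y) = (fun n => u n x).
  by apply/funext => n; have [m _ <-] := uF n; have [c _ <-] := a_cst m.
have /pointwise_cvgP ux := uf.
(* One real sequence now tends to the indicator's values at both [y] and [x], so uniqueness of
   limits forces [0 = 1]. *)
have uy : u n x @[n --> \oo] --> (\1_[set x] y : R) by rewrite -uxy; exact: ux.
have /eqP : \1_[set x] y = \1_[set x] x :> R.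
  exact: (cvg_unique (@Rhausdorff R) uy (ux x)).
by rewrite !indicE memNset ?mem_set//=; [rewrite eq_sym oner_eq0|exact/eqP].
Qed.
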